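(* Let $f(x)=c^{\mathsf T}x$ and suppose the feasible set $\Omega$ is bounded. Let $\{x^k\}_{k\in\mathbb N}$ be generated by the randomized branch-LP descent algorithm (RBLA) described in the context, and let $x^\infty:=x^N$, where $N$ is a finite, realization-dependent index such that $x^k=x^N$ for all $k\ge N$ (such an index exists on every realization). Then, almost surely, $x^\infty$ is B-stationary for $\min_{x\in\Omega}c^{\mathsf T}x$, and hence a local minimizer of this problem.
   Context: Let $n_0\ge0$, $m\ge1$ be integers, $n=n_0+2m$, and write $x=(x_0,x_1,x_2)\in\mathbb R^{n_0}\times\mathbb R^m\times\mathbb R^m$ for $x\in\mathbb R^n$. Fix matrices $A,B$ and vectors $a,b$ of compatible dimensions; vector inequalities are componentwise, $[m]=\{1,\dots,m\}$, $\mathbb N=\{0,1,\dots\}$. The feasible set is $\Omega=\{x\in\mathbb R^n: Ax-a=0,\ Bx-b\ge0,\ x_1\ge0,\ x_2\ge0,\ x_{1,i}x_{2,i}=0\ \forall i\in[m]\}$. Labels and branches: $\mathcal P$ is the set of the $2^m$ ordered pairs $J=(D_1,D_2)$ with $D_1\cup D_2=[m]$, $D_1\cap D_2=\varnothing$. For $J=(D_1,D_2)\in\mathcal P$, $\Omega_J=\{x: Ax-a=0,\ Bx-b\ge0,\ x_{1,i}=0,\,x_{2,i}\ge0\ (i\in D_1),\ x_{1,i}\ge0,\,x_{2,i}=0\ (i\in D_2)\}$, so $\Omega=\bigcup_{J\in\mathcal P}\Omega_J$. For $x\in\Omega$, the set of compatible labels is $\mathcal P(x)=\{J\in\mathcal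 P: x\in\Omega_J\}$. Tangent cone of $S\subseteq\mathbb R^n$ at $\bar x\in S$: $T_S(\bar x)=\{d:\exists\,t_\ell\downarrow0,\ d^\ell\to d,\ \bar x+t_\ell d^\ell\in S\}$. A point $\bar x\in\Omega$ is B-stationary for $\min_\Omega f$ if $\nabla f(\bar x)^{\mathsf T}d\ge0$ for all $d\in T_\Omega(\bar x)$. RBLA: start from a feasible $x^0\in\Omega$. For $k=0,1,2,\dots$: sample $J^k$ conditionally uniformly from $\mathcal P(x^k)$; choose any $\widehat x^k\in\operatorname{argmin}\{c^{\mathsf T}x: x\in\Omega_{J^k}\}$; if $c^{\mathsf T}\widehat x^k<c^{\mathsf T}x^k$ set $x^{k+1}=\widehat x^k$, otherwise set $x^{k+1}=x^k$. Probability: all random quantities live on a probability space $(\Xi,\mathcal G,\mathbb P)$ with a filtration $\{\mathcal F_k\}$ representing the information available immediately before $J^k$ is sampled; $x^k$ is $\mathcal F_k$-measurable, $J^k$ is $\mathcal F_{k+1}$-measurable, and $\mathbb P(J^k=J\mid\mathcal F_k)=\mathbf 1_{\{J\in\mathcal P(x^k)\}}/|\mathcal P(x^k)|$ for every $J\in\mathcal P$. *)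

(* Defs.v *)
From HB Require Import structures.
From mathcomp Require Import all_boot all_order all_algebra.
From mathcomp Require Import all_classical all_reals all_analysis.

Set Implicit Arguments.
Unset Strict Implicit.
Unset Printing Implicit Defensive.

Import Order.TTheory GRing.Theory Num.Theory.
Import numFieldNormedType.Exports.

Local Open Scope classical_set_scope.
Local Open Scope ring_scope.

Section Optimization.
Context {R : realType} {n : nat}.
Implicit Types (S : set 'cV[R]_n) (f : 'cV[R]_n -> R) (x y d : 'cV[R]_n).

Definition dot (u v : 'cV[R]_n) : R := (u^T *m v) 0 0.

Definition argmin S f : set 'cV[R]_n :=
  [set x | S x /\ forall y, S y -> f x <= f y].

Definition local_minimizer S f x : Prop :=
  S x /\ \forall y \near x, S y -> f x <= f y.

(* [t l] decreasing to 0 is read as: [t l] positive and tending to 0. Passing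
   to a subsequence shows that requiring [t] monotone gives the same cone. *)
Definition tangent_cone S x : set 'cV[R]_n :=
  [set d | exists (t : nat -> R) (dl : nat -> 'cV[R]_n),
    [/\ forall l, 0 < t l,
        t @ \oo --> (0 : R),
        dl @ \oo --> d &
        forall l, S (x + t l *: dl l)]].

Definition gradient f x : 'cV[R]_n := \col_i 'D_(delta_mx i 0) f x.

Definition b_stationary S f x : Prop :=
  S x /\ forall d, tangent_cone S x d -> 0 <= dot (gradient f x) d.

End Optimization.

(* Ordered pairs (D1, D2) with D1 :|: D2 = [m] and D1 :&: D2 empty. *)
Definition label (m : nat) : finType :=
  {J : {set 'I_m} * {set 'I_m} |
    (J.1 :|: J.2 == [set: 'I_m])%SET && (J.1 :&: J.2 == finset.set0)%SET}.

Section ComplementaritySet.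
Context {R : realType} {n0 m p q : nat}.
Local Notation vec := 'cV[R]_(n0 + (m + m)).
Variables (A : 'M[R]_(p, n0 + (m + m))) (a : 'cV[R]_p).
Variables (B : 'M[R]_(q, n0 + (m + m))) (b : 'cV[R]_q).

Definition x1 (x : vec) (i : 'I_m) : R := x (rshift n0 (lshift m i)) 0.
Definition x2 (x : vec) (i : 'I_m) : R := x (rshift n0 (rshift m i)) 0.

Definition Omega : set vec :=
  [set x | [/\ A *m x - a = 0,
               forall j, 0 <= (B *m x - b) j 0,
               forall i, 0 <= x1 x i,
               forall i, 0 <= x2 x i &
               forall i, x1 x i * x2 x i = 0]].

Definition branch (J : label m) : set vec :=
  [set x | [/\ A *m x - a = 0,
               forall j, 0 <= (B *m x - b) j 0,
               forall i, i \in (val J).1 -> x1 x i = 0 /\ 0 <= x2 x i &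
               forall i, i \in (val J).2 -> 0 <= x1 x i /\ x2 x i = 0]].

Definition compatible (x : vec) : {set label m} :=
  [set J : label m | `[< branch J x >]]%SET.

End ComplementaritySet.

(* [f] is measurable from the sigma-algebra [F] to the sigma-algebra [G]. *)
Definition measurable_wrt {T U : Type} (F : set (set T)) (G : set (set U))
    (f : T -> U) : Prop :=
  forall Y, G Y -> F (f @^-1` Y).

Definition borel {U : topologicalType} : set (set U) := <<s [set Y | open Y] >>.

Section Probability.
Context {disp : measure_display} {Xi : measurableType disp} {R : realType}.
Variable P : probability Xi R.

Definition filtration (F : nat -> set (set Xi)) : Prop :=
  [/\ forall k, sigma_algebra setT (F k),
      forall k, F k `<=` measurable &
      forall k l, (k <= l)%N -> F k `<=` F l].

(* [g] is a version of the conditional probability of [E] given [F]. *)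
Definition is_cond_prob (F : set (set Xi)) (E : set Xi) (g : Xi -> R) : Prop :=
  [/\ measurable_wrt F measurable g,
      P.-integrable setT (EFin \o g) &
      forall C, F C -> (\int[P]_(w in C) (g w)%:E = P (C `&` E))%E].

End Probability.

(* A run of the randomized branch-LP descent algorithm: [xhat k w] is the chosen
   minimizer over the sampled branch, an arbitrary (not necessarily measurable)
   selection. *)
Record rbla {R : realType} {n0 m p q : nat}
    (A : 'M[R]_(p, n0 + (m + m))) (a : 'cV[R]_p)
    (B : 'M[R]_(q, n0 + (m + m))) (b : 'cV[R]_q) (c : 'cV[R]_(n0 + (m + m)))
    {disp : measure_display} {Xi : measurableType disp} (P : probability Xi R)
    (F : nat -> set (set Xi))
    (x xhat : nat -> Xi -> 'cV[R]_(n0 + (m + m)))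
    (J : nat -> Xi -> label m) : Prop := Rbla {
  rbla_filtration : filtration F;
  rbla_x_adapted : forall k, measurable_wrt (F k) borel (x k);
  rbla_J_adapted : forall k, measurable_wrt (F k.+1) setT (J k);
  rbla_init : forall w, Omega A a B b (x 0%N w);
  rbla_sample : forall k (L : label m),
    is_cond_prob P (F k) (J k @^-1` [set L])
      (fun w => (L \in compatible A a B b (x k w))%:R
                / #|compatible A a B b (x k w)|%:R);
  rbla_argmin : forall k w,
    argmin (branch A a B b (J k w)) (dot c) (xhat k w);
  rbla_step : forall k w,
    x k.+1 w = if dot c (xhat k w) < dot c (x k w) then xhat k w else x k w
}.

(* Main.v *)
Require Import Defs.
From HB Require Import structures.
From mathcomp Require Import all_boot all_order all_algebra.
From mathcomp Require Import all_classical all_reals all_analysis.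

(* Each accepted step lands on a minimizer over the sampled branch, so that
   branch can never improve on the iterate again; as there are finitely many
   branches, the iterates stabilize. If a branch compatible with the limit
   contained a better point, sampling it once more would trigger another step;
   but a label that stays compatible forever is sampled infinitely often almost
   surely, since each time it has conditional probability at least 1/2^m. Hence
   the limit minimizes [c] over every branch through it, and these branches
   cover a neighbourhood of it in [Omega]. *)

Set Implicit Arguments.
Unset Strict Implicit.
Unset Printing Implicit Defensive.

Import Order.TTheory GRing.Theory Num.Theory.
Import numFieldNormedType.Exports.

Local Open Scope classical_set_scope.
Local Open Scope ring_scope.

(** * Linear objectives: gradient and B-stationarity *)

Section LinearObjective.
Context {R : realType} {n : nat}.
Implicit Types (S : set 'cV[R]_n) (c x u v : 'cV[R]_n).

Lemma dotE u v : dot u v = \sum_i u i 0 * v i 0.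
Proof. by rewrite /dot mxE; apply: eq_bigr => i _; rewrite mxE. Qed.

Lemma dotDr c u v : dot c (u + v) = dot c u + dot c v.
Proof. by rewrite /dot mulmxDr mxE. Qed.

Lemma dotZr c (t : R) v : dot c (t *: v) = t * dot c v.
Proof. by rewrite /dot -scalemxAr mxE. Qed.

Lemma dot_continuous c : continuous (dot c : 'cV[R]_n -> R).
Proof.
move=> x; rewrite /continuous_at dotE.
rewrite (_ : dot c = fun v : 'cV[R]_n => \sum_i c i 0 * v i 0); last first.
  by apply/funext => v; rewrite dotE.
have Fx : Filter (nbhs (x : 'cV[R]_n)) by exact: nbhs_filter.
suff sum_cvg (r : seq 'I_n) :
    (fun v : 'cV[R]_n => \sum_(i <- r) c i 0 * v i 0) @ x -->
    \sum_(i <- r) c i 0 * x i 0 by exact: sum_cvg.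
apply: (@cvg_big R); first exact: add_continuous.
by move=> i _; apply: cvgM; [exact: cvg_cst|exact: coord_continuous].
Qed.

Lemma gradient_dot c x : gradient (dot c) x = c.
Proof.
apply/colP => i; rewrite mxE /derive.
(* For [h != 0] the difference quotient is exactly [c i 0]. *)
apply: (@lim_near_cst R^o); first exact: norm_hausdorff.
near=> h.
have h0 : h != 0 by near: h; exact: nbhs_dnbhs_neq.
rewrite /= dotDr addrK dotZr /GRing.scale /= mulKf// dotE (bigD1 i)//=.
rewrite mxE !eqxx mulr1 big1 ?addr0// => j ji.
by rewrite mxE (negPf ji) mulr0.
Unshelve. all: by end_near. Qed.

(** Along a tangent sequence the feasible points [x + t l *: e l] tend to [x], so eventually
    [t l * dot c (e l)] is nonnegative; divide by [t l] and pass to the limit. *)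
Lemma local_minimizer_b_stationary S c x :
  local_minimizer S (dot c) x -> b_stationary S (dot c) x.
Proof.
move=> [Sx minx]; split=> // d [t [e [t0 t_cvg e_cvg Ste]]].
rewrite gradient_dot.
have te_cvg : (x + t l *: e l) @[l --> \oo] --> x.
  rewrite -[X in _ --> X]addr0 -(scale0r d).
  by apply: cvgD; [exact: cvg_cst|exact: cvgZ].
apply: (@ler_cvg_to _ \oo _ R (fun=> 0) (dot c \o e)).
- exact: cvg_cst.
- by apply: (cvg_comp _ _ e_cvg); exact: dot_continuous.
near=> l; rewrite /= -(pmulr_rge0 _ (t0 l)) -dotZr -(lerDl (dot c x)) -dotDr.
have : S (x + t l *: e l) by [].
near: l; exact: te_cvg minx.
Unshelve. all: by end_near. Qed.

End LinearObjective.

(** * Local geometry of the branches *)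

Section Branches.
Context {R : realType} {n0 m p q : nat}.
Variables (A : 'M[R]_(p, n0 + (m + m))) (a : 'cV[R]_p).
Variables (B : 'M[R]_(q, n0 + (m + m))) (b : 'cV[R]_q).
Local Notation vec := 'cV[R]_(n0 + (m + m)).
Local Notation Omega := (Omega A a B b).
Local Notation branch := (branch A a B b).
Local Notation compatible := (compatible A a B b).
Implicit Types (x y : vec) (L : label m).

Lemma compatibleP x L : reflect (branch L x) (L \in compatible x).
Proof. by rewrite inE; apply: asboolP. Qed.

Lemma label_cover L i : (i \in (val L).1) || (i \in (val L).2).
Proof. by case/andP: (valP L) => /eqP/setP/(_ i); rewrite !inE. Qed.

Lemma branch_sub_Omega L : branch L `<=` Omega.
Proof.
move=> x [eq_a ge_b D1 D2]; split => // i; have /orP[] := label_cover L i.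
- by move=> /D1[->].
- by move=> /D2[].
- by move=> /D1[].
- by move=> /D2[_ ->].
- by move=> /D1[->]; rewrite mul0r.
- by move=> /D2[_ ->]; rewrite mulr0.
Qed.

Definition label_of (D : {set 'I_m}) : label m.
Proof. by exists (D, ~: D)%SET; rewrite /= finset.setUCr finset.setICr !eqxx. Defined.

Lemma near_pos_coord x (i : 'I_(n0 + (m + m))) :
  \forall y \near x, 0 < x i 0 -> 0 < (y : vec) i 0.
Proof.
have [x0|x0] := ltP 0 (x i 0); last by near=> y.
suff : \forall y \near x, 0 < (y : vec) i 0 by apply: filterS.
exact: cvgr_gt (@coord_continuous _ _ _ i 0 x) _ x0.
Unshelve. all: by end_near. Qed.

(* Coordinates that are positive at [x] stay positive nearby, which forces
   their partners to vanish: a nearby feasible [y] shares a branch with [x]. *)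
Lemma near_common_branch x : Omega x ->
  \forall y \near x, Omega y -> exists L, branch L x /\ branch L y.
Proof.
move=> [xa xb x1_ge0 x2_ge0 x12].
have : \forall y \near x, forall i, 0 < x i 0 -> 0 < (y : vec) i 0.
  exact: filter_forall (near_pos_coord x).
apply: filterS => y pos_y [ya yb y1_ge0 y2_ge0 y12].
have zero_of (u v : R) : 0 <= u -> (0 < u -> v = 0) -> u = 0 \/ v = 0.
  by rewrite le_eqVlt => /orP[/eqP<-|u0 /(_ u0)]; [left|right].
have prod0 (u v : R) : u * v = 0 -> 0 < u -> v = 0.
  by move=> /eqP; rewrite mulf_eq0 => /orP[/eqP->|/eqP//]; rewrite ltxx.
(* Off this set [x1] is positive at [x] or at [y]. Complementarity kills [x2] at that point, and
   [pos_y] carries the conclusion over to the other one. *)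
exists (label_of [set i | (x1 x i == 0) && (x1 y i == 0)]%SET).
split; split=> //= i; rewrite !inE.
- by move=> /andP[/eqP-> _].
- rewrite negb_and => /orP[] nz; split=> //.
    by apply: (prod0 (x1 x i)) => //; rewrite lt_def nz; exact: x1_ge0.
  have [//|y10] : x2 x i = 0 \/ x1 y i = 0; last by rewrite y10 eqxx in nz.
  apply: zero_of => // x2_gt0; apply: (prod0 (x2 y i)); first by rewrite mulrC.
  exact: pos_y.
- by move=> /andP[_ /eqP->].
- rewrite negb_and => /orP[] nz; split=> //; apply: (prod0 (x1 y i)) => //.
    by apply: pos_y; rewrite lt_def nz; exact: x1_ge0.
  by rewrite lt_def nz; exact: y1_ge0.
Qed.

Lemma branch_minimizer_local (c : vec) x : Omega x ->
  (forall L y, branch L x -> branch L y -> dot c x <= dot c y) ->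
  local_minimizer Omega (dot c) x.
Proof.
move=> Ox minx; split=> //; apply: filterS (near_common_branch Ox) => y.
by move=> near_y /near_y[L [Lx Ly]]; exact: minx Lx Ly.
Qed.

End Branches.

(** * Events with conditional probability bounded below *)

Section NeverSampled.
Context {disp : measure_display} {Xi : measurableType disp} {R : realType}.
Variable P : probability Xi R.
Local Open Scope ereal_scope.

Lemma filtrationI (F : nat -> set (set Xi)) k : filtration F ->
  setI_closed (F k).
Proof.
case=> sF _ _; have subT (X : set Xi) : F k X -> X `<=` setT by [].
by have /(sigma_algebraP subT)[] := sF k.
Qed.

Lemma filtrationC (F : nat -> set (set Xi)) k D : filtration F ->
  F k D -> F k (~` D).
Proof. by case=> sF _ _ FD; rewrite -setTD; have [_ + _] := sF k; exact. Qed.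

Lemma filtrationT (F : nat -> set (set Xi)) k : filtration F -> F k setT.
Proof.
by move=> hF; rewrite -setC0; apply: filtrationC => //; case: hF => /(_ k)[].
Qed.

(* The event that [E k] holds and [H k] fails for [N <= k < N + j] loses a
   factor [1 - e] of its mass at each step. *)
Lemma negligible_never (F : nat -> set (set Xi)) (E H : nat -> set Xi) (e : R)
    (N : nat) :
  filtration F -> (0 < e <= 1)%R ->
  (forall k, F k (E k)) -> (forall k, F k.+1 (H k)) ->
  (forall k C, F k C -> C `<=` E k -> e%:E * P C <= P (C `&` H k)) ->
  P.-negligible [set w | forall k, (N <= k)%N -> E k w /\ ~ H k w].
Proof.
move=> hF /andP[e_gt0 e_le1] FE FH PH.
have [_ F_meas F_mono] := hF.
pose G := fix G j := if j is i.+1 then G i `&` E (N + i)%N `\` H (N + i)%N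
                     else setT.
(* [G j] involves only the times before [N + j]; its last [H] is known exactly from time [N + j]
   on. *)
have FG j : F (N + j)%N (G j).
  elim: j => [|j IHj]; first exact: filtrationT.
  rewrite /= setDE addnS; apply: filtrationI => //; last first.
    exact: filtrationC.
  by apply: (F_mono (N + j)%N) => //; exact: filtrationI.
have mG j : measurable (G j) by exact: F_meas (FG j).
have decay j : P (G j.+1) <= (1 - e)%:E * P (G j).
  have FD : F (N + j)%N (G j `&` E (N + j)%N) by exact: filtrationI.
  have mD := F_meas _ _ FD.
  have P_fin C : measurable C -> P C \is a fin_num by exact: fin_num_measure.
  have mH := F_meas _ _ (FH (N + j)%N).
  rewrite /= measureD//; last by rewrite ltey_eq P_fin.
  apply: (@le_trans _ _ ((1 - e)%:E * P (G j `&` E (N + j)%N))).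
    rewrite EFinB muleBl ?P_fin// mul1e leeB// PH//; exact: subIsetr.
  apply: lee_wpmul2l; first by rewrite lee_fin subr_ge0.
  by apply: le_measure; rewrite ?inE//; exact: subIsetl.
have geometric_bound j : P (G j) <= ((1 - e) ^+ j)%:E.
  elim: j => [|j IHj]; first by rewrite expr0 probability_le1.
  apply: le_trans (decay j) _; rewrite exprS EFinM.
  by apply: lee_wpmul2l => //; rewrite lee_fin subr_ge0.
have mcapG : measurable (\bigcap_j G j) by exact: bigcapT_measurable.
apply: (@negligibleS _ _ _ _ (\bigcap_j G j)).
  move=> w never j _; elim: j => //= j IHj.
  by have [Ew nHw] := never (N + j)%N (leq_addr _ _).
apply/negligibleP => //; apply/eqP; rewrite eq_le measure_ge0 andbT.
rewrite -(fineK (fin_num_measure P _ mcapG)) lee_fin.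
(* The intersection has measure at most every power of [1 - e], and [0 <= 1 - e < 1]. *)
have pow_cvg : (GRing.exp (1 - e) @ \oo --> 0)%R.
  by apply: cvg_expr; rewrite ger0_norm ?subr_ge0// ltrBlDr ltrDl.
apply: ler_cvg_to (cvg_cst _) pow_cvg _.
apply: nearW => j /=; rewrite -lee_fin fineK ?fin_num_measure//.
apply: le_trans (geometric_bound j); apply: le_measure; rewrite ?inE//.
exact: bigcap_inf.
Qed.

(** Integrate [e <= g] over [C]. This turns a pointwise bound on the conditional probability into
    the last hypothesis of [negligible_never]. *)
Lemma cond_prob_ge (F : nat -> set (set Xi)) k (H C : set Xi) (g : Xi -> R)
    (e : R) :
  filtration F -> is_cond_prob P (F k) H g -> F k C -> (0 <= e)%R ->
  (forall w, C w -> e <= g w)%R -> e%:E * P C <= P (C `&` H).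
Proof.
move=> [_ F_meas _] [g_meas g_int g_cond] FC e_ge0 e_le_g.
have mC := F_meas _ _ FC.
rewrite -g_cond// -integral_cst//; apply: ge0_le_integral => //.
exact: measurable_funS (measurable_int _ g_int).
Qed.

End NeverSampled.

(** Once [u] attains the least value of its range, it can no longer decrease. *)
Lemma nonincreasing_nat_stationary (u : nat -> nat) :
  (forall k, (u k.+1 <= u k)%N) ->
  exists N, forall k, (N <= k)%N -> u k = u N.
Proof.
move=> u_dec.
have u_mono N k : (N <= k)%N -> (u k <= u N)%N.
  move=> /subnK<-; elim: (k - N)%N => [//|j]; exact: leq_trans (u_dec _).
have [v vP vmin] := ex_minnP (ex_intro (fun v => `[< exists k, u k = v >]) (u 0%N)
  (asboolT (ex_intro _ 0%N erefl))).
move/asboolP: vP => [N uN]; exists N => k Nk; apply/eqP.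
by rewrite eqn_leq u_mono//= uN; apply: vmin; apply/asboolP; exists k.
Qed.

(** * Runs of the algorithm: stabilization and optimality of the limit *)

Section Run.
Context {R : realType} {n0 m p q : nat}.
Variables (A : 'M[R]_(p, n0 + (m + m))) (a : 'cV[R]_p).
Variables (B : 'M[R]_(q, n0 + (m + m))) (b : 'cV[R]_q).
Variable c : 'cV[R]_(n0 + (m + m)).
Context {disp : measure_display} {Xi : measurableType disp}.
Variables (P : probability Xi R) (F : nat -> set (set Xi)).
Variables (x xhat : nat -> Xi -> 'cV[R]_(n0 + (m + m))).
Variable J : nat -> Xi -> label m.
Hypothesis hrun : rbla A a B b c P F x xhat J.
Local Notation branch := (branch A a B b).
Local Notation Omega := (Omega A a B b).
Local Notation compatible := (compatible A a B b).

Lemma rbla_feasible k w : Omega (x k w).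
Proof.
elim: k => [|k IHk]; first exact: (rbla_init hrun).
rewrite (rbla_step hrun); case: ifP => // _.
by have [+ _] := rbla_argmin hrun k w; exact: branch_sub_Omega.
Qed.

Lemma rbla_descent k w : dot c (x k.+1 w) <= dot c (x k w).
Proof. by rewrite (rbla_step hrun); case: ifP => [/ltW|_]. Qed.

(** An accepted step moves to a minimizer of the branch; a rejected one means that the iterate was
    already at least as good as that minimizer. *)
Lemma rbla_next_le_branch k w y : branch (J k w) y ->
  dot c (x k.+1 w) <= dot c y.
Proof.
have [_ xhat_min] := rbla_argmin hrun k w => /xhat_min.
rewrite (rbla_step hrun); case: ltP => // + hat_y.
by move=> /le_trans; exact.
Qed.

(* Each accepted step removes the sampled label from the finite set of labels
   whose branch improves on the current iterate. *)
Lemma rbla_stationary w :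
  exists N : nat, forall k, (N <= k)%N -> x k w = x N w.
Proof.
pose improving k := [set L : label m |
  `[< exists2 y, branch L y & dot c y < dot c (x k w) >]]%SET.
have improvingP k L : reflect (exists2 y, branch L y & dot c y < dot c (x k w))
    (L \in improving k) by rewrite inE; exact: asboolP.
have improving_dec k : improving k.+1 \subset improving k.
  apply/fintype.subsetP => L /improvingP[y Ly y_lt]; apply/improvingP.
  by exists y => //; exact: lt_le_trans y_lt (rbla_descent k w).
have [N card_stable] := @nonincreasing_nat_stationary (fun k => #|improving k|)
  (fun k => subset_leq_card (improving_dec k)).
have stable k : (N <= k)%N -> x k.+1 w = x k w.
  move=> Nk; rewrite (rbla_step hrun); case: ifP => // accepted.
  have [Jhat _] := rbla_argmin hrun k w.
  have : J k w \in improving k by apply/improvingP; exists (xhat k w).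
  (* Equal cardinalities make the inclusion an equality, so the sampled label would still be
     improving after the step. *)
  have /subset_leqif_cards[_] := improving_dec k.
  rewrite !card_stable ?(leqW Nk)// eqxx => /esym/eqP<- /improvingP[y Jy].
  by rewrite ltNge rbla_next_le_branch.
exists N => k /subnK<-; elim: (k - N)%N => [//|j <-].
by rewrite addSn stable// leq_addl.
Qed.

(** The sampling weight of [L] is [F k]-measurable and nonzero exactly on this event. *)
Lemma rbla_compatible_event k L :
  F k [set w | L \in compatible (x k w)].
Proof.
have [g_meas _ _] := rbla_sample hrun k L.
suff -> : [set w | L \in compatible (x k w)] =
    (fun w => (L \in compatible (x k w))%:R / #|compatible (x k w)|%:R : R) @^-1`
    (~` [set 0]).
  by apply: g_meas; apply: measurableC; exact: measurable_set1.
apply/seteqP; split=> w /=.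
  move=> LJ; rewrite LJ mul1r; apply/eqP; rewrite invr_eq0 pnatr_eq0 -lt0n.
  by apply/card_gt0P; exists L.
by case: (L \in _) => // /(_ _); rewrite mul0r; exact.
Qed.

Lemma negligible_rbla_never L N :
  P.-negligible [set w | forall k, (N <= k)%N ->
    L \in compatible (x k w) /\ J k w <> L].
Proof.
have hF := rbla_filtration hrun.
have label_gt0 : (0 < #|label m|)%N by apply/card_gt0P; exists L.
(* The constant is the smallest possible uniform weight, when all labels are compatible. *)
apply: (@negligible_never _ _ _ _ F (fun k => [set w | L \in compatible (x k w)])
  (fun k => J k @^-1` [set L]) #|label m|%:R^-1) => //.
- by rewrite invr_gt0 ltr0n label_gt0 invf_le1 ?ltr0n// ler1n.
- by move=> k; exact: rbla_compatible_event.
- by move=> k; exact: (rbla_J_adapted hrun).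
move=> k C FC CE; apply: cond_prob_ge (rbla_sample hrun k L) FC _ _ => //.
move=> w /CE /= Lw; rewrite Lw mul1r lef_pV2 ?posrE ?ltr0n//.
  by rewrite ler_nat max_card.
by apply/card_gt0P; exists L.
Qed.

(** Finitely many labels and countably many starting times give a countable union of null sets. *)
Lemma ae_rbla_sampled : {ae P, forall w, forall L N,
  (forall k, (N <= k)%N -> L \in compatible (x k w)) ->
  exists2 k, (N <= k)%N & J k w = L}.
Proof.
apply: filter_forall => L; apply: ae_foralln => N.
apply: negligibleS (negligible_rbla_never L N) => w /= never k Nk.
apply: contrapT => fail_k; apply: never => compat.
by exists k => //; apply: contrapT => JL; apply: fail_k; split=> //; exact: compat.
Qed.

Lemma ae_rbla_limit_local_minimizer (N : Xi -> nat) :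
  (forall w k, (N w <= k)%N -> x k w = x (N w) w) ->
  {ae P, forall w, local_minimizer Omega (dot c) (x (N w) w)}.
Proof.
move=> x_stable; apply: filterS ae_rbla_sampled => w sampled.
apply: branch_minimizer_local; first exact: rbla_feasible.
move=> L y Lx Ly; have [k Nk JL] : exists2 k, (N w <= k)%N & J k w = L.
  (* [sampled] holds for all starting times on one almost sure event, so it applies at the
     realization-dependent [N w]. *)
  by apply: sampled => k Nk; rewrite x_stable//; apply/compatibleP.
(* The iterate following the sampling of [L] is still the limit, hence no worse than any point of
   that branch. *)
by rewrite -(x_stable w k.+1 (leqW Nk)); apply: rbla_next_le_branch; rewrite JL.
Qed.

End Run.

Theorem theorem1 (R : realType) (n0 m p q : nat) (hm : (1 <= m)%N)
    (A : 'M[R]_(p, n0 + (m + m))) (a : 'cV[R]_p)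
    (B : 'M[R]_(q, n0 + (m + m))) (b : 'cV[R]_q)
    (c : 'cV[R]_(n0 + (m + m)))
    (hbounded : bounded_set (Omega A a B b))
    (disp : measure_display) (Xi : measurableType disp) (P : probability Xi R)
    (F : nat -> set (set Xi))
    (x xhat : nat -> Xi -> 'cV[R]_(n0 + (m + m)))
    (J : nat -> Xi -> label m)
    (hrun : rbla A a B b c P F x xhat J) :
  (forall w, exists N : nat, forall k, (N <= k)%N -> x k w = x N w) /\
  (forall N : Xi -> nat,
    (forall w k, (N w <= k)%N -> x k w = x (N w) w) ->
    {ae P, forall w,
      b_stationary (Omega A a B b) (dot c) (x (N w) w) /\
      local_minimizer (Omega A a B b) (dot c) (x (N w) w)}).
Proof.
split=> [w|N x_stable]; first exact: rbla_stationary hrun w.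
apply: filterS (ae_rbla_limit_local_minimizer hrun x_stable) => w min_w.
by split=> //; exact: local_minimizer_b_stationary.
Qed.
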